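(* Assume that $H$ is an infinite-dimensional separable real Hilbert space and let $(e_n)_{n\ge1}$ be an orthonormal sequence in $H$. Let $\mathbb P_n$ be the law on $\Omega_H=C_0([0,T];H)$ of $X_t=W_te_n$, where $W$ is a standard real Brownian motion. Then $\mathbb P_n\in\mathfrak S_{1,0}^{0,T}(H)$ for every $n$, and for every compact $K\subset C_0([0,T];H)$, $$\sup_{n\ge1}\mathbb P_n(K^c)=c_{\mathfrak S_{1,0}^{0,T}(H)}(K^c)=1.$$ Consequently the trace-clock class $\mathfrak S_{1,0}^{0,T}(H)$ is not uniformly tight and admits no compact capacity core. Moreover, no positive trace-class operator $\Gamma$ on $H$ satisfies $e_n\otimes e_n\preceq\Gamma$ for every $n$.
   Context: $0<T<\infty$. $C_0([0,T];H)$ is the space of continuous paths from $0$ with the uniform topology. $\mathfrak S_{\Lambda,B}^{0,T}(H)$ is the family of all laws $P$ on $\Omega_H$ under which the coordinate process satisfies $X_t=M_t^P+\int_0^tb_r^Pdr$ with $\|b_r^P\|\le B$ and $M^P$ a continuous local martingale with operator bracket $d\langle\!\langle M^P\rangle\!\rangle_t=a_t^Pdt$, $a_t^P$ positive trace class, $\operatorname{Tr}a_t^P\le\Lambda$ ($dt\otimes P$-a.e.). For a law family $\mathcal P$, $c_{\mathcal P}(E)=\sup_{P\in\mathcal P}P^*(E)$ (outer probability). $\mathcal P$ is uniformly tight if for every $\varepsilon>0$ there is a compact $K$ with $\sup_{P\in\mathcal P}P(K^c)<\varepsilon$; a compact capacity core is an increasing sequence of compact sets $K_R$ with $c_{\mathcal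 P}(K_R^c)\to0$. $x\otimes y:h\mapsto\langle y,h\rangle x$; $\preceq$ is the operator order. *)

(* Defs.v *)
From HB Require Import structures.
From mathcomp Require Import all_boot all_order all_algebra.
From mathcomp Require Import all_classical all_reals all_analysis.

Set Implicit Arguments.
Unset Strict Implicit.
Unset Printing Implicit Defensive.

Import Order.TTheory GRing.Theory Num.Theory.
Import numFieldNormedType.Exports.

Local Open Scope classical_set_scope.
Local Open Scope ring_scope.

(* A path is a function on the whole line that vanishes outside [0, T], so that
   it is determined by its restriction to [0, T]. *)
Record C0 (R : realType) (T : R) (H : normedModType R) := MkC0 {
  C0_fun :> R -> H ;
  C0_continuous : {within `[0, T], continuous C0_fun} ;
  C0_start : C0_fun 0 = 0 ;
  C0_outside : forall t, t \notin `[0, T] -> C0_fun t = 0 }.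

Section PathSpace.
Variables (R : realType) (T : R) (H : normedModType R).

Lemma C0_cst0_continuous : {within `[0, T], continuous (fun _ : R => 0 : H)}.
Proof. by move=> x; exact: cvg_cst. Qed.

HB.instance Definition _ := gen_eqMixin (C0 T H).
HB.instance Definition _ := gen_choiceMixin (C0 T H).
HB.instance Definition _ := isPointed.Build (C0 T H)
  (MkC0 C0_cst0_continuous erefl (fun _ _ => erefl)).

HB.instance Definition _ := Uniform.copy (C0 T H)
  (initial_topology (@C0_fun R T H : C0 T H -> {uniform` `[0, T] -> H})).

HB.instance Definition _ := Measurable.copy (C0 T H)
  (g_sigma_algebraType (@open (C0 T H))).

Definition coord_process (t : R) (w : C0 T H) : H := w t.

End PathSpace.

Section Hilbert.
Variables (R : realType) (H : completeNormedModType R).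

Definition separable_space (V : topologicalType) :=
  exists2 D : set V, countable D & dense D.

Definition infinite_dimensional :=
  forall (n : nat) (v : 'I_n -> H),
    exists x : H, forall c : 'I_n -> R, x <> \sum_(i < n) c i *: v i.

Variable ip : H -> H -> R.

Definition orthonormal_seq (e : nat -> H) :=
  forall m n, ip (e m) (e n) = (m == n)%:R.

(* A basis is given as a set of vectors rather than as an enumeration. *)
Definition orthonormal_basis (E : set H) :=
  [/\ forall x, E x -> ip x x = 1,
      forall x y, E x -> E y -> x <> y -> ip x y = 0
    & forall h, (forall x, E x -> ip h x = 0) -> h = 0].

Definition positive_op (A : H -> H) :=
  [/\ linear A, continuous A,
      forall h k, ip (A h) k = ip h (A k)
    & forall h, 0 <= ip (A h) h].

Definition op_le (A B : H -> H) := positive_op (fun h => B h - A h).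

Definition tensor (x y : H) : H -> H := fun h => ip y h *: x.

(* For a positive operator the sum is the same in every orthonormal basis. *)
Definition has_trace (A : H -> H) (r : R) :=
  forall E, orthonormal_basis E ->
    (\esum_(x in E) (ip (A x) x)%:E = r%:E)%E.

Definition positive_trace_class (A : H -> H) :=
  positive_op A /\ exists r, has_trace A r.

Definition trace_le (A : H -> H) (L : R) :=
  exists2 r, has_trace A r & r <= L.

End Hilbert.

Section Processes.
Variables (R : realType) (T : R).

Definition filtration_of (O : Type) (V : topologicalType) (Y : R -> O -> V)
    (t : R) : set (set O) :=
  <<s \bigcup_(s in `[0, t]) preimage_set_system setT (Y s) open >>.

Section OneProcess.
Variables (d : measure_display) (O : measurableType d).
Variables (F : R -> set (set O)) (P : probability O R).

Definition adapted (V : topologicalType) (X : R -> O -> V) :=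
  forall t, t \in `[0, T] -> forall U : set V, open U -> F t (X t @^-1` U).

(* measurability of X on [0, t] * O for the product of the Borel
   sigma-algebra of [0, t] with F t *)
Definition progressive (V : topologicalType) (X : R -> O -> V) :=
  forall t, t \in `[0, T] -> forall U : set V, open U ->
    <<s [set A `*` B | A in (@measurable _ R) & B in F t] >>
      [set p : R * O | p.1 \in `[0, t] /\ U (X p.1 p.2)].

(* Since `|X t| is integrable, the Bochner integrals of X t and X s over A are
   equal as soon as their inner products with every h are; for V = R the pairing
   is the multiplication. *)
Definition martingale (V : normedModType R) (ip : V -> V -> R)
    (X : R -> O -> V) :=
  [/\ adapted X,
      forall t, t \in `[0, T] -> P.-integrable setT (fun w => (`|X t w|)%:E)
    & forall s t, 0 <= s -> s <= t -> t <= T -> forall A, F s A ->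
      forall h : V, (\int[P]_(w in A) (ip (X t w) h)%:E
                     = \int[P]_(w in A) (ip (X s w) h)%:E)%E].

(* On the bounded interval [0, T] a localizing sequence eventually reaches T. *)
Definition local_martingale (V : normedModType R) (ip : V -> V -> R)
    (X : R -> O -> V) :=
  exists tau : nat -> O -> R,
  [/\ forall n t, t \in `[0, T] -> F t [set w | tau n w <= t],
      forall n w, 0 <= tau n w,
      forall w, nondecreasing_seq (tau ^~ w),
      {ae P, forall w, exists n, T <= tau n w}
    & forall n, martingale ip (fun t w => X (Num.min t (tau n w)) w)].

(* d<<M>>_t = a_t dt : M (x) M - \int_0^. a_r dr is a local martingale, tested
   on all pairs of vectors h, k *)
Definition bracket_density (H : completeNormedModType R) (ip : H -> H -> R)
    (M : R -> O -> H) (a : R -> O -> H -> H) :=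
  forall h k : H, local_martingale ( *%R : R -> R -> R)
    (fun t w => ip (M t w) h * ip (M t w) k
       - \int[lebesgue_measure]_(r in `[0, t]) ip (a r w h) k : R).

Definition standard_brownian (W : R -> O -> R) :=
  [/\ forall t, t \in `[0, T] -> measurable_fun setT (W t),
      forall w, W 0 w = 0,
      forall w, {within `[0, T], continuous (W ^~ w)},
      forall s t, 0 <= s -> s < t -> t <= T ->
        forall A, measurable A ->
        P ((W t \- W s)%R @^-1` A)
        = normal_prob 0 (Num.sqrt (t - s)) A
    & forall s t, 0 <= s -> s < t -> t <= T ->
        forall A B, filtration_of W s A -> measurable B ->
        (P (A `&` (W t \- W s)%R @^-1` B)
        = P A * P ((W t \- W s)%R @^-1` B))%E].

End OneProcess.

Section LawClass.
Variables (H : completeNormedModType R) (ip : H -> H -> R).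

(* Filtration: the one generated by the coordinate process. The identity
   X = M + \int b is the H-valued one, tested on every h. *)
Definition trace_clock_class (L B : R) : set (probability (C0 T H) R) :=
  [set P : probability (C0 T H) R |
    let F := filtration_of (@coord_process R T H) in
    exists (M b : R -> C0 T H -> H) (a : R -> C0 T H -> H -> H),
    [/\ [/\ progressive F b
          & {ae (lebesgue_measure \x P)%E, forall p : R * C0 T H,
              p.1 \in `[0, T] -> `|b p.1 p.2| <= B}],
        {ae P, forall w, forall t, t \in `[0, T] -> forall h,
           ip (coord_process t w) h = ip (M t w) h
             + \int[lebesgue_measure]_(r in `[0, t]) ip (b r w) h},
        [/\ forall w, {within `[0, T], continuous (M ^~ w)}
          & local_martingale F P ip M],
        [/\ forall h k, progressive F (fun t w => ip (a t w h) k : R)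
          & {ae (lebesgue_measure \x P)%E, forall p : R * C0 T H,
              p.1 \in `[0, T] ->
              positive_trace_class ip (a p.1 p.2)
              /\ trace_le ip (a p.1 p.2) L}]
      & bracket_density F P ip M a]].

End LawClass.
End Processes.

Section Capacity.
Local Open Scope ereal_scope.
Variables (R : realType) (d : measure_display) (O : measurableType d).

Definition outer_prob (P : probability O R) (E : set O) : \bar R :=
  ereal_inf [set P A | A in [set A | measurable A /\ E `<=` A]].

Definition capacity (PP : set (probability O R)) (E : set O) : \bar R :=
  ereal_sup [set outer_prob P E | P in PP].
End Capacity.

Section Tightness.
Local Open Scope ereal_scope.
Variables (R : realType) (T : R) (H : normedModType R).
Implicit Type PP : set (probability (C0 T H) R).

Definition uniformly_tight PP :=
  forall eps : R, (0 < eps)%R -> exists2 K : set (C0 T H), compact K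
    & ereal_sup [set P (~` K) | P in PP] < eps%:E.

Definition compact_capacity_core PP (K : nat -> set (C0 T H)) :=
  [/\ forall n, compact (K n),
      forall m n, (m <= n)%N -> K m `<=` K n
    & capacity PP (~` (K n)) @[n --> \oo] --> 0].
End Tightness.

(* Main.v *)
From HB Require Import structures.
Require Import Defs.
From mathcomp Require Import all_boot all_order all_algebra.
From mathcomp Require Import all_classical all_reals all_analysis.
From mathcomp Require Import measurable_realfun ring lra.
Import Order.TTheory GRing.Theory Num.Theory.
Import numFieldNormedType.Exports.
Local Open Scope classical_set_scope.
Local Open Scope ring_scope.

(** Brownian motion along a unit vector [u] is its own martingale part, without
    drift, and its bracket grows at the constant rate [u (x) u]. This operator
    has trace one in every orthonormal basis by Parseval's identity, so the law
    lies in the class with trace bound [1] and drift bound [0], whatever the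
    direction [u] ([law_in_trace_clock_class]). The two martingale properties
    involved, those of [W] and of [W ^+ 2 - t], follow from the independence of
    the increments and from the first two moments of the centered normal law
    ([brownian_increment_test], [normal_mean], [normal_second_moment]).

    Moving the direction along an orthonormal sequence makes the laws escape
    from every compact set [K]. The coefficients of a fixed vector along the
    sequence tend to zero by Bessel's inequality, and the functionals
    [ip (w T) (e n)] are equicontinuous in the path [w]; hence they become
    smaller than any given [delta] on all of [K] at once
    ([compact_uniform_coef]). Under the law of index [n], however, that
    functional is distributed as [W T], a Gaussian variable independent of [n]
    whose density is bounded, so it is smaller than [delta] only with a
    probability of order [delta]. Therefore the mass that these laws leave on
    [K] tends to zero ([compact_complement_law_sup]). As compact sets of paths
    are closed, outer probability is plain probability on their complements:
    the capacity of the complement of a compact set is one, which excludes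
    uniform tightness and a compact capacity core.

    Finally, an operator above every [e n (x) e n] has diagonal coefficients at
    least one along the sequence; in an orthonormal basis that extends the
    sequence, which exists by Zorn's lemma, its trace diverges
    ([no_trace_class_majorant]). *)

(** * Inner products, Parseval's identity and the trace of a rank-one projection *)

Section InnerProduct.
Variables (R : realType) (H : completeNormedModType R) (ip : {dot H for idfun}).
Hypothesis ip_norm : forall x : H, ip x x = `|x| ^+ 2.

Lemma ipC x y : ip x y = ip y x.
Proof. by rewrite hermC expr0 mul1r. Qed.

Lemma ip_suml (I : Type) (s : seq I) (f : I -> H) y :
  ip (\sum_(i <- s) f i) y = \sum_(i <- s) ip (f i) y.
Proof. exact: linear_sumlz. Qed.

Lemma ip_quadratic x y (t : R) :
  0 <= `|x| ^+ 2 - t * ip x y *+ 2 + t ^+ 2 * `|y| ^+ 2.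
Proof.
have -> : `|x| ^+ 2 - t * ip x y *+ 2 + t ^+ 2 * `|y| ^+ 2
    = `|x - t *: y| ^+ 2; last exact: sqr_ge0.
rewrite -!ip_norm linearBl !linearBr !linearZl_LR !linearZr_LR /=.
by rewrite (ipC y x); ring.
Qed.

Lemma cauchy_schwarz x y : `|ip x y| <= `|x| * `|y|.
Proof.
have [->|y0] := eqVneq y 0; first by rewrite linear0r !normr0 mulr0.
have ny : 0 < `|y| ^+ 2 by rewrite exprn_gt0 // normr_gt0.
rewrite -(@ler_pXn2r _ 2) ?nnegrE ?mulr_ge0 // real_normK ?num_real //.
(* This value of the parameter minimizes the quadratic polynomial. *)
have /(mulr_ge0 (ltW ny)) := ip_quadratic x y (ip x y / `|y| ^+ 2).
have -> : `|y| ^+ 2 * (`|x| ^+ 2 - ip x y / `|y| ^+ 2 * ip x y *+ 2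
   + (ip x y / `|y| ^+ 2) ^+ 2 * `|y| ^+ 2)
   = (`|x| * `|y|) ^+ 2 - ip x y ^+ 2.
  by field; rewrite normr_eq0.
by rewrite subr_ge0.
Qed.

Lemma ip_continuous h : continuous (ip ^~ h).
Proof.
move=> x; apply/cvgrPdist_le => eps eps0.
near=> y.
rewrite -linearBl /= (le_trans (cauchy_schwarz _ _)) //.
apply: (@le_trans _ _ (`|x - y| * (`|h| + 1))).
  by rewrite ler_wpM2l // lerDl.
rewrite -ler_pdivlMr; last by rewrite ltr_wpDl.
near: y; apply: cvgr_dist_le; first exact: cvg_id.
by rewrite divr_gt0 // ltr_wpDl.
Unshelve. all: by end_near. Qed.

Definition orthonormal_set (E : set H) :=
  (forall x, E x -> ip x x = 1)
  /\ (forall x y, E x -> E y -> x <> y -> ip x y = 0).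

Definition fourier_sum (s : seq H) (h : H) := \sum_(x <- s) ip h x *: x.

Section Bessel.
Variables (E : set H) (onE : orthonormal_set E).

Lemma ip_fourier_sum s h x : uniq s -> (forall y, y \in s -> E y) -> E x ->
  ip (fourier_sum s h) x = if x \in s then ip h x else 0.
Proof.
case: onE => on1 on0 us sE Ex; rewrite /fourier_sum ip_suml.
under eq_bigr do rewrite linearZl_LR /=.
case: ifPn => xs.
  rewrite (bigD1_seq x) //= on1 // mulr1 big_seq_cond big1 ?addr0 // => y.
  by move=> /andP[/sE Ey /eqP yx]; rewrite (on0 y x) ?mulr0.
rewrite big_seq_cond big1 // => y; rewrite andbT => ys.
rewrite (on0 y x) ?mulr0 //; first exact: sE.
by move=> yx; rewrite -yx ys in xs.
Qed.

Lemma fourier_sum_norm s h : uniq s -> (forall y, y \in s -> E y) ->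
  `|fourier_sum s h| ^+ 2 = \sum_(x <- s) ip h x ^+ 2.
Proof.
move=> us sE; rewrite -ip_norm {2}/fourier_sum ipC ip_suml.
rewrite !big_seq; apply: eq_bigr => x xs.
by rewrite linearZl_LR /= (ipC x) ip_fourier_sum // ?xs ?expr2 //; exact: sE.
Qed.

(** Pythagoras: [h - fourier_sum s h] is orthogonal to [fourier_sum s h]. *)
Lemma bessel_defect s h : uniq s -> (forall y, y \in s -> E y) ->
  `|h - fourier_sum s h| ^+ 2 = `|h| ^+ 2 - \sum_(x <- s) ip h x ^+ 2.
Proof.
move=> us sE; rewrite -fourier_sum_norm // -!ip_norm linearBl !linearBr /=.
have hp : ip h (fourier_sum s h) = ip (fourier_sum s h) (fourier_sum s h).
  rewrite ip_norm fourier_sum_norm // ipC ip_suml; apply: eq_bigr => x _.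
  by rewrite linearZl_LR /= (ipC x) expr2.
by rewrite (ipC (fourier_sum s h) h) hp subrr subr0.
Qed.

Lemma bessel s h : uniq s -> (forall y, y \in s -> E y) ->
  \sum_(x <- s) ip h x ^+ 2 <= `|h| ^+ 2.
Proof. by move=> us sE; rewrite -subr_ge0 -bessel_defect // sqr_ge0. Qed.

(** Bessel's defect identity applied to the larger partial sum, whose
    coefficients along the smaller family are those of [h]. *)
Lemma fourier_sum_increment s s' h : uniq s -> uniq s' ->
  {subset s <= s'} -> (forall y, y \in s' -> E y) ->
  `|fourier_sum s' h - fourier_sum s h| ^+ 2
  = \sum_(x <- s') ip h x ^+ 2 - \sum_(x <- s) ip h x ^+ 2.
Proof.
move=> us us' ss' s'E.
have sE : (forall y, y \in s -> E y) by move=> y /ss'; exact: s'E.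
set p := fourier_sum s' h.
have coef x : x \in s -> ip p x = ip h x.
  by move=> xs; rewrite /p ip_fourier_sum ?(ss' _ xs) //; exact: sE.
have -> : fourier_sum s h = fourier_sum s p.
  by rewrite /fourier_sum !big_seq; apply: eq_bigr => x /coef ->.
rewrite bessel_defect // {1}/p fourier_sum_norm //; congr (_ - _).
by rewrite !big_seq; apply: eq_bigr => x /coef ->.
Qed.

End Bessel.

Lemma orthonormal_basis_set E :
  orthonormal_basis ip E -> orthonormal_set E.
Proof. by case=> on1 on0 _; split. Qed.

Lemma esum_family_le (E : set H) (h : H) s : uniq s ->
  (forall y, y \in s -> E y) ->
  ((\sum_(x <- s) ip h x ^+ 2)%:E <= \esum_(x in E) (ip h x ^+ 2)%:E)%E.
Proof.
move=> us sE; apply: esum_ge; exists [set` s].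
  by split; [exact: finite_seq|exact: sE].
by rewrite -fsbig_seq // sumEFin.
Qed.

Lemma esum_family_adherent (E : set H) (h : H) (r eps : R) : 0 < eps ->
  (\esum_(x in E) (ip h x ^+ 2)%:E = r%:E)%E ->
  exists s : seq H, [/\ uniq s, forall y, y \in s -> E y
    & r - eps < \sum_(x <- s) ip h x ^+ 2].
Proof.
move=> eps0 Er; have /ereal_sup_gt[_ [A [finA AE] <-]] :
    ((r - eps)%:E < \esum_(x in E) (ip h x ^+ 2)%:E)%E.
  by rewrite Er lte_fin ltrBlDr ltrDl.
rewrite fsbig_finite //= sumEFin lte_fin => lt_s.
exists (finmap.enum_fset (fset_set A)); split => //; first exact: finmap.fset_uniq.
by move=> y; rewrite in_fset_set // inE => /AE.
Qed.

(** The basis may be uncountable. Finite families whose sums of squared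
    coefficients approach the supremum have partial Fourier sums that form a
    Cauchy sequence, since enlarging such a family hardly changes its partial
    sum; the limit has the same coefficients as [h], so totality of the basis
    identifies it with [h]. *)
Lemma parseval E h : orthonormal_basis ip E ->
  (\esum_(x in E) (ip h x ^+ 2)%:E = (`|h| ^+ 2)%:E)%E.
Proof.
move=> onb; have onE := orthonormal_basis_set _ onb.
have le_h : (\esum_(x in E) (ip h x ^+ 2)%:E <= (`|h| ^+ 2)%:E)%E.
  apply: ge_ereal_sup => _ [A [finA AE] <-].
  rewrite fsbig_finite //= sumEFin lee_fin; apply: (bessel E) => //.
    exact: finmap.fset_uniq.
  by move=> y; rewrite in_fset_set // inE => /AE.
have ge_0 : (0 <= \esum_(x in E) (ip h x ^+ 2)%:E)%E.
  by apply: esum_ge0 => x _; rewrite lee_fin sqr_ge0.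
have [r Er] : exists r, (\esum_(x in E) (ip h x ^+ 2)%:E = r%:E)%E.
  exists (fine (\esum_(x in E) (ip h x ^+ 2)%:E)).
  rewrite fineK // fin_numE -ltNye -ltey (lt_le_trans (ltNyr 0)) //.
  by rewrite (le_lt_trans le_h) // ltry.
have eps_gt0 n : 0 < (n.+1%:R^-1 : R) ^+ 2 by rewrite exprn_gt0.
(* The squared gap makes the n-th partial sum (n + 1)^-1-close to every larger
   one. *)
have /choice[S SP] : forall n, exists s : seq H,
    [/\ uniq s, forall y, y \in s -> E y
    & r - (n.+1%:R^-1) ^+ 2 < \sum_(x <- s) ip h x ^+ 2].
  by move=> n; exact: (esum_family_adherent E h r _ (eps_gt0 n) Er).
pose p n := fourier_sum (S n) h.
have enlarge n s' : uniq s' -> {subset S n <= s'} ->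
    (forall y, y \in s' -> E y) -> `|fourier_sum s' h - p n| <= n.+1%:R^-1.
  move=> us' Ss' s'E; have [uS _ ltS] := SP n.
  rewrite -(@ler_pXn2r _ 2) ?nnegrE // (fourier_sum_increment E) //.
  have := esum_family_le E h s' us' s'E; rewrite Er lee_fin => s'r.
  by rewrite lerBlDr (le_trans s'r) // -lerBlDl ltW.
have p_cvg : cvgn p.
  apply/cauchy_cvgP/cauchy_exP => eps eps0.
  have eps2 : 0 < eps / 2 by rewrite divr_gt0.
  have [N _ /= ltN] := near_infty_natSinv_lt (PosNum eps2).
  exists (p N); exists N => // n /= Nn; rewrite -ball_normE /= distrC.
  have [[uN SN _] [un Sn _]] := (SP N, SP n).
  (* Neither family need contain the other: both are compared with their union. *)
  pose U := undup (S N ++ S n).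
  have UE y : y \in U -> E y.
    by rewrite mem_undup mem_cat => /orP[/SN|/Sn].
  have UN : {subset S N <= U}.
    by move=> y yS; rewrite mem_undup mem_cat yS.
  have Un : {subset S n <= U}.
    by move=> y yS; rewrite mem_undup mem_cat yS orbT.
  have dN := enlarge N U (undup_uniq _) UN UE.
  have dn := enlarge n U (undup_uniq _) Un UE.
  rewrite (splitr eps) -(subrKA (fourier_sum U h)) (le_lt_trans (ler_normD _ _)) //.
  rewrite distrC ltrD //.
    exact: (le_lt_trans dn (ltN n Nn)).
  exact: (le_lt_trans dN (ltN N (leqnn N))).
set l := lim (p @ \oo); have pl : p n @[n --> \oo] --> l := p_cvg.
have l_coef x : E x -> ip (h - l) x = 0.
  move=> Ex.
  have small n : `|ip (h - p n) x| <= n.+1%:R^-1.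
    have [un Sn _] := SP n.
    pose U := undup (x :: S n).
    have UE y : y \in U -> E y.
      by rewrite mem_undup inE => /orP[/eqP->|/Sn].
    have Un : {subset S n <= U}.
      by move=> y yS; rewrite mem_undup inE yS orbT.
    have xU : x \in U by rewrite mem_undup mem_head.
    have -> : ip (h - p n) x = ip (fourier_sum U h - p n) x.
      by rewrite !linearBl /= (ip_fourier_sum E onE U) ?undup_uniq ?xU.
    apply: (le_trans (cauchy_schwarz _ _)).
    have -> : `|x| = 1.
      by apply/eqP; rewrite -(@eqrXn2 _ 2) // expr1n -ip_norm; case: onE => ->.
    by rewrite mulr1; exact: enlarge n U (undup_uniq _) Un UE.
  have to0 : ip (h - p n) x @[n --> \oo] --> (0 : R).
    apply/norm_cvg0P; apply: (@squeeze_cvgr _ _ _ _ (cst 0) harmonic).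
    - by near=> n; rewrite normr_ge0 small.
    - exact: cvg_cst.
    - exact: cvg_harmonic.
  have to_l : ip (h - p n) x @[n --> \oo] --> ip (h - l) x.
    apply: (@continuous_cvg _ _ _ _ _ (fun n => h - p n) (ip ^~ x)).
      exact: ip_continuous.
    by apply: cvgB => //; exact: cvg_cst.
  exact: (cvg_unique _ to_l to0).
have hl : h = l by apply/eqP; rewrite -subr_eq0; apply/eqP; case: onb => _ _; exact.
apply/eqP; rewrite eq_le le_h Er lee_fin /=.
have : `|p n| ^+ 2 @[n --> \oo] --> `|h| ^+ 2.
  rewrite hl; apply: (@continuous_cvg _ _ _ _ _ (fun n => `|p n|) (fun x => x ^+ 2)).
    exact: exprn_continuous.
  exact: cvg_norm.
move=> /cvgr_to_le; apply; near=> n; have [un Sn _] := SP n.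
rewrite (fourier_sum_norm E) //.
by have := esum_family_le E h (S n) un Sn; rewrite Er lee_fin.
Unshelve. all: by end_near. Qed.

(** Zorn's lemma gives a maximal orthonormal set orthogonal to [S]; its union
    with [S] is total because a vector orthogonal to it could be normalized and
    added. *)
Lemma orthonormal_extension (S : set H) : orthonormal_set S ->
  exists2 E, orthonormal_basis ip E & S `<=` E.
Proof.
move=> [S1 S0].
pose P := [set A : set H | orthonormal_set A
  /\ forall x y, A x -> S y -> ip x y = 0].
have [F FP totF|A [[[A1 A0] AS] maxA]] := @Zorn_bigcup H P.
  split; last by move=> x y [B FB Bx]; case: (FP _ FB) => _; exact.
  split=> [x [B FB Bx]|x y [B FB Bx] [C FC Cy] xy].
    by have [[+ _] _] := FP _ FB; exact.
  have [BC|CB] := totF _ _ FB FC.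
    by have [[_ +] _] := FP _ FC; apply => //; exact: BC.
  by have [[_ +] _] := FP _ FB; apply => //; exact: CB.
exists (A `|` S); last by move=> x; right.
split=> [x [/A1|/S1] //|x y [Ax|Sx] [Ay|Sy] xy|h h0].
- exact: A0.
- exact: AS.
- by rewrite ipC; exact: AS.
- exact: S0.
apply: contrapT => /eqP nh0.
have nh : `|h| != 0 by rewrite normr_eq0.
pose u := `|h|^-1 *: h.
have uu : ip u u = 1.
  by rewrite ip_norm normrZ normfV normr_id mulVf // expr1n.
have u0 x : (A `|` S) x -> ip u x = 0.
  by move=> /h0 hx; rewrite linearZl_LR /= hx mulr0.
have nAu : ~ A u.
  by move=> Au; have := u0 u (or_introl Au); rewrite uu => /eqP; rewrite oner_eq0.
apply: (maxA (A `|` [set u])).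
  split; first by move=> x; left.
  by move=> /(_ u (or_intror erefl)).
split; [split|].
- by move=> x [/A1 //|->].
- move=> x y [Ax|->] [Ay|->] xy //; first exact: A0.
  + by rewrite ipC; apply: u0; left.
  + by apply: u0; left.
- move=> x y [Ax|->] Sy; first exact: AS.
  by apply: u0; right.
Qed.

Lemma tensor_positive (x : H) : positive_op ip (tensor ip x x).
Proof.
split.
- by move=> a u v; rewrite /tensor linearD linearZ_LR /= scalerDl scalerA.
- move=> u; apply: (@continuous_cvg _ _ _ _ _ (ip x) ( *:%R ^~ x)).
    by apply: scalel_continuous.
  have -> : ip x = ip ^~ x :> (H -> R) by apply/funext => y; rewrite ipC.
  exact: ip_continuous.
- move=> h k; rewrite /tensor linearZl_LR linearZr_LR /=.
  by rewrite (ipC h x) mulrC.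
- by move=> h; rewrite /tensor linearZl_LR /= -expr2 sqr_ge0.
Qed.

(** Parseval's identity, since the diagonal coefficients of the rank-one operator
    are the squared coefficients of [x]. *)
Lemma tensor_trace (x : H) : has_trace ip (tensor ip x x) (`|x| ^+ 2).
Proof.
move=> E onb; rewrite -(parseval E) //; apply: eq_esum => y _.
by rewrite /tensor linearZl_LR /= expr2.
Qed.

Lemma orthonormal_seq_norm (e : nat -> H) n : orthonormal_seq ip e -> `|e n| = 1.
Proof.
by move=> eon; apply/eqP; rewrite -(@eqrXn2 _ 2) // expr1n -ip_norm eon eqxx.
Qed.

Lemma orthonormal_seq_inj (e : nat -> H) : orthonormal_seq ip e -> injective e.
Proof.
move=> eon m n emn; have := eon m n; rewrite emn eon eqxx.
by case: eqVneq => // _ /eqP; rewrite oner_eq0.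
Qed.

Lemma orthonormal_seq_range (e : nat -> H) : orthonormal_seq ip e ->
  orthonormal_set (range e).
Proof.
move=> eon; split=> [_ [n _ <-]|_ _ [m _ <-] [n _ <-] emn].
  by rewrite eon eqxx.
by rewrite eon; case: eqVneq => // mn; case: emn; rewrite mn.
Qed.

(** A majorant has diagonal coefficients at least one along the sequence, so its
    trace computed in a basis that extends the sequence is infinite. *)
Lemma no_trace_class_majorant (e : nat -> H) : orthonormal_seq ip e ->
  ~ (exists2 G : H -> H, positive_trace_class ip G
       & forall n, op_le ip (tensor ip (e n) (e n)) G).
Proof.
move=> eon [G [_ [r Gr]] maj].
have [E onb eE] := orthonormal_extension _ (orthonormal_seq_range e eon).
have Ge n : 1 <= ip (G (e n)) (e n).
  have [_ _ _ /(_ (e n))] := maj n.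
  by rewrite /tensor linearBl linearZl_LR /= eon eqxx mulr1 subr_ge0.
have big n : (n%:R%:E <= \esum_(x in E) (ip (G x) x)%:E)%E.
  apply: esum_ge; exists (e @` `I_n).
    split; first exact/finite_image/finite_II.
    by move=> _ [m _ <-]; apply: eE; exists m.
  rewrite fsbig_image //; last first.
    by move=> i j _ _; exact: orthonormal_seq_inj.
  rewrite -fsbig_ord sumEFin lee_fin -[n in n%:R]card_ord -sumr_const.
  by apply: ler_sum => i _.
have := big (Num.truncn r).+1; rewrite (Gr E onb) lee_fin leNgt.
by rewrite truncnS_gt.
Qed.

(** The squared coefficients of a vector are summable by Bessel's inequality. *)
Lemma orthonormal_coef_cvg0 (e : nat -> H) (x : H) : orthonormal_seq ip e ->
  ip x (e n) @[n --> \oo] --> (0 : R).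
Proof.
move=> eon; have einj := orthonormal_seq_inj e eon.
have bnd n : series (fun n => ip x (e n) ^+ 2) n <= `|x| ^+ 2.
  rewrite /series /= -(big_map e xpredT (fun y => ip x y ^+ 2)).
  apply: (bessel (range e)); first exact: orthonormal_seq_range.
    by rewrite map_inj_uniq ?iota_uniq.
  by move=> _ /mapP[k _ ->]; exists k.
have : cvgn (series (fun n => ip x (e n) ^+ 2)).
  apply: nondecreasing_is_cvgn.
    by apply/nondecreasing_series => n _ _; exact: sqr_ge0.
  by exists (`|x| ^+ 2) => _ [n _ <-]; exact: bnd.
move=> /cvg_series_cvg_0 sq0; apply/cvgr0Pnorm_lt => eps eps0.
near=> n.
rewrite -(@ltr_pXn2r _ 2) ?nnegrE ?(ltW eps0) // real_normK ?num_real //.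
rewrite -[X in X < _]ger0_norm ?sqr_ge0 //.
near: n; apply: cvgr0_norm_lt sq0 _ _; exact: exprn_gt0.
Unshelve. all: by end_near. Qed.

End InnerProduct.

(** * The first two moments of the centered normal law *)

Section NormalMoments.
Context {R : realType}.
Local Notation mu := (@lebesgue_measure R).

(** The density is a Radon-Nikodym derivative, and two such derivatives agree
    almost everywhere. *)
Lemma ge0_integral_normal_prob (m s : R) (f : R -> \bar R) :
  measurable_fun [set: R] f -> (forall x, 0 <= f x)%E ->
  (\int[normal_prob m s]_x f x = \int[mu]_x (f x * (normal_pdf m s x)%:E))%E.
Proof.
move=> mf f0.
have dom := normal_prob_dominates m s.
rewrite -(Radon_Nikodym_SigmaFinite.change_of_variables dom f0 measurableT mf).
have mpdf : measurable_fun setT (EFin \o normal_pdf m s).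
  by apply/measurable_EFinP; apply: measurable_normal_pdf.
apply: ae_eq_integral => //=.
- apply: emeasurable_funM => //; apply: (measurable_int mu).
  exact: Radon_Nikodym_SigmaFinite.f_integrable.
- exact: emeasurable_funM.
- apply: ae_eqe_mul2l; apply: integral_ae_eq => //=.
  + exact: Radon_Nikodym_SigmaFinite.f_integrable.
  + by move=> E _ mE; rewrite -Radon_Nikodym_SigmaFinite.f_integral.
Qed.

Variable s : R.
Hypothesis s_gt0 : 0 < s.
Local Notation phi := (normal_pdf 0 s).

Let s_neq0 : s != 0. Proof. by rewrite gt_eqF. Qed.

Lemma normal_pdf_centeredE x :
  phi x = normal_peak s * expR (- (x ^+ 2 / (s ^+ 2 *+ 2))).
Proof. by rewrite normal_pdfE // /normal_fun subr0 mulNr. Qed.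

Lemma normal_pdf_sym x : phi (- x) = phi x.
Proof. by rewrite !normal_pdf_centeredE sqrrN. Qed.

(** As [phi' x = - x / s ^+ 2 * phi x], this provides a primitive of
    [(x ^+ 2 - s ^+ 2) * phi x] that vanishes at zero and at infinity, which
    reduces the second moment to the total mass. *)
Lemma is_derive_mulx_normal_pdf (x : R) :
  is_derive x (1 : R) (fun y : R => - s ^+ 2 * (y * phi y))
    (x ^+ 2 * phi x - s ^+ 2 * phi x).
Proof.
under eq_fun do rewrite normal_pdf_centeredE.
apply: is_derive_eq.
rewrite !normal_pdf_centeredE /GRing.scale /=; field.
exact: s_neq0.
Qed.

(** The inequality [expR q >= 1 + q] bounds [x * phi x] by a multiple of
    [x^-1]. *)
Lemma cvg_mulx_normal_pdf : (n.+1%:R * phi n.+1%:R) @[n --> \oo] --> (0 : R).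
Proof.
apply: (@squeeze_cvgr _ _ _ _ (cst 0)
    (fun n => normal_peak s * (s ^+ 2 *+ 2) * harmonic n)).
- near=> n; rewrite mulr_ge0 ?normal_pdf_ge0 //= normal_pdf_centeredE.
  set x : R := n.+1%:R; have x0 : 0 < x by rewrite ltr0n.
  have v0 : 0 < s ^+ 2 *+ 2 by rewrite mulrn_wgt0 // exprn_gt0.
  have q0 : 0 < x ^+ 2 / (s ^+ 2 *+ 2) by rewrite divr_gt0 // exprn_gt0.
  have expq : expR (- (x ^+ 2 / (s ^+ 2 *+ 2))) <= (x ^+ 2 / (s ^+ 2 *+ 2))^-1.
    rewrite expRN lef_pV2 ?posrE ?expR_gt0 // (le_trans _ (expR_ge1Dx _)) //.
    by rewrite lerDr.
  apply: (@le_trans _ _ (normal_peak s * (x * (x ^+ 2 / (s ^+ 2 *+ 2))^-1))).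
    by rewrite mulrCA !ler_wpM2l ?normal_peak_ge0 // ltW.
  rewrite -mulrA ler_wpM2l ?normal_peak_ge0 // le_eqVlt; apply/orP; left.
  by apply/eqP; field; rewrite s_neq0 gt_eqF.
- exact: cvg_cst.
- rewrite -(mulr0 (normal_peak s * (s ^+ 2 *+ 2))).
  by apply: cvgM; [exact: cvg_cst|exact: cvg_harmonic].
Unshelve. all: by end_near. Qed.

Lemma normal_pdf_second_moment_itv n :
  (\int[mu]_(x in `[0%R, n.+1%:R%R]) (x ^+ 2 * phi x)%:E
   = (s ^+ 2)%:E * \int[mu]_(x in `[0%R, n.+1%:R%R]) (phi x)%:E
     - (s ^+ 2 * (n.+1%:R * phi n.+1%:R))%:E)%E.
Proof.
have n0 : 0 < n.+1%:R :> R by rewrite ltr0n.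
have cphi : continuous phi by exact: continuous_normal_pdf.
have cxphi : continuous (fun x : R => x ^+ 2 * phi x).
  move=> x; apply: cvgM; last exact: cphi.
  exact: exprn_continuous.
have csphi : continuous (fun x : R => s ^+ 2 * phi x).
  by move=> x; apply: cvgM; [exact: cvg_cst|exact: cphi].
have cint (f : R -> R) : continuous f ->
    mu.-integrable `[0, n.+1%:R] (EFin \o f).
  move=> cf; apply: continuous_compact_integrable; first exact: segment_compact.
  exact: continuous_subspaceT.
have dG x : derivable (fun y : R => - s ^+ 2 * (y * phi y)) x (1 : R).
  by have [] := is_derive_mulx_normal_pdf x.
have cG : continuous (fun y : R => - s ^+ 2 * (y * phi y)).
  by move=> x; apply/differentiable_continuous/derivable1_diffP.
have := @continuous_FTC2 R (fun x => x ^+ 2 * phi x - s ^+ 2 * phi x)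
  (fun y => - s ^+ 2 * (y * phi y)) 0 n.+1%:R n0.
rewrite mul0r mulr0 sube0 => FTC.
have : (\int[mu]_(x in `[0%R, n.+1%:R%R]) (x ^+ 2 * phi x - s ^+ 2 * phi x)%:E
   = (- s ^+ 2 * (n.+1%:R * phi n.+1%:R))%:E)%E.
  apply: FTC.
  - apply: continuous_subspaceT => x; apply: cvgB; [exact: cxphi|exact: csphi].
  - split; first by move=> x _; exact: dG.
      by apply: cvg_at_right_filter; exact: cG.
    by apply: cvg_at_left_filter; exact: cG.
  - move=> x _; rewrite derive1E.
    by have := is_derive_mulx_normal_pdf x; move=> /@derive_val ->.
under eq_integral do rewrite EFinB.
rewrite integralB //=; [|exact: cint|exact: cint].
under [X in (_ - X)%E = _ -> _]eq_integral do rewrite EFinM.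
rewrite integralZl //=; last exact: cint.
have fin f : continuous f -> (\int[mu]_(x in `[0%R, n.+1%:R%R]) (f x)%:E)%E \is a fin_num.
  by move=> cf; apply: integrable_fin_num => //; exact: cint.
move: (fin _ cxphi) (fin _ cphi).
case: (integral _ _ _) => // a _; case: (integral _ _ _) => // b _.
rewrite -!EFinM -!EFinB => -[ab]; congr EFin; lra.
Qed.

Lemma normal_pdf_second_moment_halfline :
  (\int[mu]_(x in `[0%R, +oo[) (x ^+ 2 * phi x)%:E
   = (s ^+ 2)%:E * \int[mu]_(x in `[0%R, +oo[) (phi x)%:E)%E.
Proof.
have phi0 x : 0 <= phi x by exact: normal_pdf_ge0.
have mphi : measurable_fun [set: R] phi by exact: measurable_normal_pdf.
have mxphi : measurable_fun [set: R] (fun x => x ^+ 2 * phi x).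
  by apply: measurable_funM => //; exact: exprn_measurable.
have x0 x : 0 <= x ^+ 2 * phi x by rewrite mulr_ge0 // sqr_ge0.
have fin_phi : (\int[mu]_(x in `[0%R, +oo[) (phi x)%:E)%E \is a fin_num.
  apply: integrable_fin_num => //.
  by apply: (integrableS measurableT) => //; exact: integrable_normal_pdf.
have shift (f : R -> R) : (forall x, 0 <= f x) -> measurable_fun [set: R] f ->
    (\int[mu]_(x in `[0%R, n.+1%:R%R]) (f x)%:E)%E @[n --> \oo]
      --> (\int[mu]_(x in `[0%R, +oo[) (f x)%:E)%E.
  move=> f0 mf.
  rewrite (cvg_shiftS (fun n => \int[mu]_(x in `[0%R, n%:R%R]) (f x)%:E)%E).
  exact: ge0_cvgn_integral.
suff lim : (\int[mu]_(x in `[0%R, n.+1%:R%R]) (x ^+ 2 * phi x)%:E)%E @[n --> \oo]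
    --> ((s ^+ 2)%:E * \int[mu]_(x in `[0%R, +oo[) (phi x)%:E)%E.
  exact: (cvg_unique _ (shift _ x0 mxphi) lim).
rewrite (eq_cvg _ _ normal_pdf_second_moment_itv).
set l := (_ * _)%E; rewrite -(sube0 l) {}/l.
apply: cvgeB.
- by rewrite fin_num_adde_defl.
- by apply: cvgeZl => //; exact: shift.
- apply: cvg_EFin; first exact: nearW.
  rewrite -[X in _ --> X](mulr0 (s ^+ 2)).
  by apply: cvgM; [exact: cvg_cst|exact: cvg_mulx_normal_pdf].
Qed.

(** Both integrands are even, so the identity on the half-line suffices. *)
Lemma normal_second_moment :
  (\int[normal_prob 0 s]_x (x ^+ 2)%:E = (s ^+ 2)%:E)%E.
Proof.
have cphi : continuous phi by exact: continuous_normal_pdf.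
rewrite ge0_integral_normal_prob; last 2 first.
- by apply/measurable_EFinP; exact: exprn_measurable.
- by move=> x; rewrite lee_fin sqr_ge0.
under eq_integral do rewrite -EFinM.
rewrite (ge0_symfun_integralT (f := fun x => x ^+ 2 * phi x)); first last.
- by move=> x /=; rewrite sqrrN normal_pdf_sym.
- move=> x; apply: cvgM; last exact: cphi.
  exact: exprn_continuous.
- by move=> x; rewrite mulr_ge0 ?sqr_ge0 ?normal_pdf_ge0.
have := integral_normal_pdf 0 s.
rewrite (ge0_symfun_integralT (f := phi)); first last.
- by move=> x /=; rewrite normal_pdf_sym.
- exact: cphi.
- by move=> x; exact: normal_pdf_ge0.
rewrite -!set_itvcy normal_pdf_second_moment_halfline muleCA => ->.
by rewrite mule1.
Qed.

Lemma normal_integrable_sqr :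
  (normal_prob 0 s).-integrable [set: R] (fun x => (x ^+ 2)%:E).
Proof.
apply/integrableP; split.
  by apply/measurable_EFinP; exact: exprn_measurable.
under eq_integral do rewrite gee0_abs ?lee_fin ?sqr_ge0 //.
by rewrite normal_second_moment ltry.
Qed.

Lemma normal_integrable_id :
  (normal_prob 0 s).-integrable [set: R] (fun x => x%:E).
Proof.
have int1 : (normal_prob 0 s).-integrable [set: R] (fun x => (1 + x ^+ 2)%:E).
  under eq_fun do rewrite EFinD.
  apply: integrableD => //; last exact: normal_integrable_sqr.
  exact: finite_measure_integrable_cst.
apply: le_integrable int1 => //.
- by apply/measurable_EFinP; exact: measurable_id.
- move=> x _; rewrite lee_fin /= [leRHS]ger0_norm; last by rewrite addr_ge0 ?sqr_ge0.
  have := sqr_ge0 (`|x| - 1); rewrite sqrrB1 real_normK ?num_real // => h.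
  by have := normr_ge0 x; lra.
Qed.

(** The reflection [x |-> - x] preserves the density and exchanges the positive
    and the negative part of the identity; both integrals are finite. *)
Lemma normal_mean : (\int[normal_prob 0 s]_x x%:E = 0)%E.
Proof.
pose f (x : R) : \bar R := x%:E.
have mf : measurable_fun [set: R] f by apply/measurable_EFinP; exact: measurable_id.
have mphi : measurable_fun [set: R] (EFin \o phi).
  by apply/measurable_EFinP; exact: measurable_normal_pdf.
have vanish (g : R -> \bar R) (D : set R) : (forall x, ~ D x -> g x = 0%E) ->
    (\int[mu]_(x in D) g x = \int[mu]_x g x)%E.
  move=> gD; rewrite integral_mkcond; congr integral; apply/funext => x.
  by rewrite patchE; case: ifPn => // /negP; rewrite inE => /gD.
have symm : (\int[normal_prob 0 s]_x (f^\+)%E x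
    = \int[normal_prob 0 s]_x (f^\-)%E x)%E.
  have mpos : measurable_fun [set: R] (f^\+)%E by exact: measurable_funepos.
  have mneg : measurable_fun [set: R] (f^\-)%E by exact: measurable_funeneg.
  rewrite ge0_integral_normal_prob // ge0_integral_normal_prob //.
  rewrite -(vanish _ `[0%R, +oo[%classic); last first.
    move=> x /= /negP; rewrite in_itv /= andbT -ltNge => x0.
    by rewrite funeposE /f -EFin_max max_r ?mul0e // ltW.
  rewrite -[RHS](vanish _ `]-oo, 0%R]%classic); last first.
    move=> x /= /negP; rewrite in_itv /= -ltNge => x0.
    by rewrite funenegE /f -EFinN -EFin_max max_r ?mul0e // oppr_le0 ltW.
  rewrite ge0_integration_by_substitution0.
  - apply: eq_integral => x _.
    by rewrite normal_pdf_sym funeposE funenegE /f EFinN.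
  - exact: emeasurable_funM.
  - by move=> x; rewrite mule_ge0 // lee_fin normal_pdf_ge0.
rewrite integralE -/f symm subee //.
by apply: integrable_fin_num => //; apply: integrable_funeneg => //; exact: normal_integrable_id.
Qed.

End NormalMoments.

(** * Integrating out an independent variable *)

Section Independence.
Context {R : realType} {d d' d2 : measure_display} {O : measurableType d}
  {T1 : measurableType d'} {T2 : measurableType d2}.
Variables (Q : probability O R) (N : probability T2 R).

(** Independence says that the joint law of [Y] and [g] is the product of the
    law of [Y] with [N], so Fubini's theorem integrates [g] out first. *)
Lemma independent_integral0 (Y : O -> T1) (g : O -> T2) (k : T1 * T2 -> \bar R) :
  measurable_fun setT Y -> measurable_fun setT g -> measurable_fun setT k ->
  (forall B C, measurable B -> measurable C ->
    Q (Y @^-1` B `&` g @^-1` C) = Q (Y @^-1` B) * N C)%E ->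
  (forall x, \int[N]_y k (x, y) = 0)%E ->
  Q.-integrable setT (fun w => k (Y w, g w)) ->
  (\int[Q]_w k (Y w, g w) = 0)%E.
Proof.
move=> mY mg mk indep k0 intk.
pose Z w := (Y w, g w).
have mZ : measurable_fun setT Z by exact: measurable_fun_pair.
pose Yf : {mfun O >-> T1} := HB.pack Y (isMeasurableFun.Build _ _ _ _ Y mY).
pose Zf : {mfun O >-> (T1 * T2)%type} :=
  HB.pack Z (isMeasurableFun.Build _ _ _ _ Z mZ).
have prodE X : measurable X ->
    (distribution Q Yf \x N)%E X = distribution Q Zf X.
  apply: product_measure_unique => B C mB mC; exact: indep.
have eqI (f : T1 * T2 -> \bar R) :
    (\int[distribution Q Zf]_z f z = \int[distribution Q Yf \x N]_z f z)%E.
  by apply: eq_measure_integral => X mX _; exact/esym/prodE.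
have intZ : (distribution Q Zf).-integrable setT k.
  exact: (@integrable_pushforward _ _ _ _ _ Z mZ Q setT k mk intk).
have intP : (distribution Q Yf \x N)%E.-integrable setT k.
  apply/integrableP; split => //; rewrite -eqI.
  by case/integrableP : intZ.
rewrite -[LHS](integral_distribution (X := Zf)) // eqI.
rewrite -integral12_prod_meas1 //.
by rewrite integral0_eq // => x _; rewrite /fubini_F k0.
Qed.

End Independence.

(** * The martingales of Brownian motion and of its square *)

Section Brownian.
Variables (R : realType) (T : R).
Variables (d : measure_display) (O : measurableType d) (Q : probability O R).
Variables (W : R -> O -> R) (W_bm : standard_brownian T Q W).
Implicit Types s t : R.

Local Notation past s := (\bigcup_(r in `[0, s]) preimage_set_system setT (W r) open).

Lemma brownian_measurable t : 0 <= t -> t <= T -> measurable_fun setT (W t).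
Proof. by move=> t0 tT; case: W_bm => + _ _ _ _; apply; rewrite in_itv /= t0. Qed.

Lemma brownian_past_measurable s A : s <= T ->
  filtration_of W s A -> measurable A.
Proof.
move=> sT; apply: smallest_sub; first exact: sigma_algebra_measurable.
move=> _ [r /= + [U oU <-]]; rewrite in_itv /= => /andP[r0 rs].
apply: (brownian_measurable r r0 (le_trans rs sT)) => //.
exact: open_measurable.
Qed.

Lemma brownian_present_measurable s : 0 <= s ->
  measurable_fun (T := g_sigma_algebraType (past s)) setT (W s).
Proof.
move=> s0; apply: (measurability _ (RGenOpens.measurableE R)).
move=> _ [U [a [b ->]] <-].
apply: sub_sigma_algebra; exists s; first by rewrite /= in_itv /= s0 lexx.
exists `]a, b[%classic => //; exact: interval_open.
Qed.

Lemma integrable_law (g : O -> R) (m : {measure set (measurableTypeR R) -> \bar R})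
    (h : R -> \bar R) :
  measurable_fun setT g -> measurable_fun [set: R] h ->
  (forall B, measurable B -> Q (g @^-1` B) = m B) ->
  m.-integrable setT h -> Q.-integrable setT (h \o g).
Proof.
move=> mg mh law /integrableP[_ hoo]; apply/integrableP; split.
  exact: measurableT_comp.
apply: le_lt_trans hoo.
pose gf : {mfun O >-> measurableTypeR R} :=
  HB.pack g (isMeasurableFun.Build _ _ _ _ (g : O -> measurableTypeR R) mg).
rewrite -[X in (X <= _)%E](ge0_integral_distribution (P := Q) gf
  (f := fun x => `|h x|%E)) //; last first.
  exact: measurableT_comp.
by rewrite (eq_measure_integral m) // => B mB _; exact: law.
Qed.

Lemma brownian_sqr_integrable t : 0 <= t -> t <= T ->
  Q.-integrable setT (fun w => (W t w ^+ 2)%:E).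
Proof.
move=> t0 tT; have mWt := brownian_measurable t t0 tT.
case: W_bm => _ W0 _ law _.
have [->|tn0] := eqVneq t 0.
  have -> : (fun w => (W 0 w ^+ 2)%:E) = cst 0%E.
    by apply/funext => w; rewrite W0 expr0n.
  exact: integrable0.
have tp : 0 < t by rewrite lt_neqAle eq_sym tn0.
apply: (integrable_law (W t) (normal_prob 0 (Num.sqrt t)) (fun x => (x ^+ 2)%:E)) => //.
- by apply/measurable_EFinP; exact: exprn_measurable.
- move=> B mB; have := law 0 t (lexx 0) tp tT B mB; rewrite subr0.
  have -> : (W t \- W 0)%R = W t by apply/funext => w /=; rewrite W0 subr0.
  exact.
- by apply: normal_integrable_sqr; rewrite sqrtr_gt0.
Qed.

Lemma brownian_integrable t : 0 <= t -> t <= T ->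
  Q.-integrable setT (fun w => (W t w)%:E).
Proof.
move=> t0 tT.
have int1 : Q.-integrable setT (fun w => (1 + W t w ^+ 2)%:E).
  under eq_fun do rewrite EFinD.
  apply: integrableD => //; last exact: brownian_sqr_integrable.
  exact: finite_measure_integrable_cst.
apply: le_integrable int1 => //.
- by apply/measurable_EFinP; exact: brownian_measurable.
- move=> w _; rewrite lee_fin /= [leRHS]ger0_norm; last by rewrite addr_ge0 ?sqr_ge0.
  have := sqr_ge0 (`|W t w| - 1); rewrite sqrrB1 real_normK ?num_real // => h.
  by have := normr_ge0 (W t w); lra.
Qed.

(** The martingale criterion for functions of the current value: it suffices
    that [u (x + y) - v x] has mean zero in [y] under the law of the increment
    for every fixed [x]. The pair formed by the indicator of a past event and
    the current value is measurable with respect to the past, hence independent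
    of the increment. *)
Lemma brownian_increment_test s t A (u v : R -> R) :
  0 <= s -> s < t -> t <= T -> filtration_of W s A ->
  measurable_fun setT u -> measurable_fun setT v ->
  Q.-integrable setT (fun w => (u (W t w))%:E) ->
  Q.-integrable setT (fun w => (v (W s w))%:E) ->
  (forall x, (normal_prob 0 (Num.sqrt (t - s))).-integrable setT
     (fun y => (u (x + y) - v x)%:E)) ->
  (forall x, \int[normal_prob 0 (Num.sqrt (t - s))]_y (u (x + y) - v x)%:E = 0)%E ->
  (\int[Q]_(w in A) (u (W t w))%:E = \int[Q]_(w in A) (v (W s w))%:E)%E.
Proof.
move=> s0 st tT FA mu mv iu iv ik k0.
have sT : s <= T by exact: (le_trans (ltW st) tT).
have t0 : 0 <= t by exact: (le_trans s0 (ltW st)).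
have mA := brownian_past_measurable s A sT FA.
have mWs := brownian_measurable s s0 sT.
have mWt := brownian_measurable t t0 tT.
pose g w := W t w - W s w.
have mg : measurable_fun setT g by exact: measurable_funB.
pose Y w : R * R := (\1_A w, W s w).
have mY : measurable_fun setT Y.
  by apply: measurable_fun_pair => //; exact: measurable_indic.
pose k (z : (R * R) * R) : \bar R :=
  (z.1.1 * (u (z.1.2 + z.2) - v z.1.2))%:E.
have mk : measurable_fun setT k.
  apply/measurable_EFinP; apply: measurable_funM.
    by apply: measurableT_comp => //; exact: measurable_fst.
  apply: measurable_funB.
    apply: measurableT_comp => //; apply: measurable_funD => //.
    by apply: measurableT_comp => //; exact: measurable_snd.
  apply: measurableT_comp => //.
  by apply: measurableT_comp => //; exact: measurable_snd.
have indep B C : measurable B -> measurable C ->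
    (Q (Y @^-1` B `&` g @^-1` C)
     = Q (Y @^-1` B) * normal_prob 0 (Num.sqrt (t - s)) C)%E.
  move=> mB mC; case: W_bm => _ _ _ law ind.
  have FY : filtration_of W s (Y @^-1` B).
    have mYs : measurable_fun (T := g_sigma_algebraType (past s)) setT Y.
      apply: measurable_fun_pair; last exact: brownian_present_measurable.
      exact: measurable_indic.
    by have := mYs measurableT B mB; rewrite setTI.
  by rewrite -(law s t s0 st tT C mC); exact: ind.
have kE w : (k (Y w, g w) = ((u (W t w))%:E - (v (W s w))%:E) * (\1_A w)%:E)%E.
  by rewrite /k /Y /g /= (addrC (W s w)) subrK mulrC EFinM EFinB.
have iuv : Q.-integrable setT (fun w => ((u (W t w))%:E - (v (W s w))%:E)%E).
  exact: integrableB.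
have iA (f : O -> \bar R) : Q.-integrable setT f -> Q.-integrable A f.
  by move=> intf; apply: (integrableS measurableT mA).
have zero := @independent_integral0 R _ _ _ O _ (measurableTypeR R) Q
  (normal_prob 0 (Num.sqrt (t - s))) Y g k mY mg mk indep.
have : (\int[Q]_(w in A) ((u (W t w))%:E - (v (W s w))%:E) = 0)%E.
  rewrite integral_mkcond -[RHS]zero.
  - apply: eq_integral => w _; rewrite kE patchE indicE.
    by case: (w \in A); rewrite ?mule1 ?mule0.
  - move=> [a x] /=; under eq_integral do rewrite /k /= EFinM.
    by rewrite integralZl // k0 mule0.
  - rewrite (_ : (fun w => _) = (fun w => ((u (W t w))%:E - (v (W s w))%:E)%E) \_ A).
      by apply/(integrable_mkcond _ mA); exact: iA.
    apply/funext => w; rewrite kE patchE indicE.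
    by case: (w \in A); rewrite ?mule1 ?mule0.
rewrite integralB //; [|exact: iA|exact: iA].
have := integrable_fin_num mA (iA _ iu); have := integrable_fin_num mA (iA _ iv).
case: (integral _ _ _) => // a _; case: (integral _ _ _) => // b _.
by rewrite -EFinB => -[/eqP]; rewrite subr_eq0 => /eqP ->.
Qed.

(** Here [(x + y) * c - x * c = y * c], which has mean zero in [y]. *)
Lemma brownian_martingale s t A (c : R) :
  0 <= s -> s <= t -> t <= T -> filtration_of W s A ->
  (\int[Q]_(w in A) (W t w * c)%:E = \int[Q]_(w in A) (W s w * c)%:E)%E.
Proof.
move=> s0; rewrite le_eqVlt => /predU1P[->//|st] tT FA.
have sT := le_trans (ltW st) tT.
have t0 := le_trans s0 (ltW st).
have sg0 : 0 < Num.sqrt (t - s) by rewrite sqrtr_gt0 subr_gt0.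
have intc r : 0 <= r -> r <= T -> Q.-integrable setT (fun w => (W r w * c)%:E).
  move=> r0 rT; under eq_fun do rewrite EFinM.
  by apply: integrableZr => //; exact: brownian_integrable.
have mc : measurable_fun [set: R] (fun x => x * c).
  by apply: measurable_funM.
have E x y : ((x + y) * c - x * c)%:E = (y%:E * c%:E)%E.
  by rewrite -EFinM; congr EFin; ring.
apply: (brownian_increment_test s t A (fun x => x * c) (fun x => x * c)) => //.
- exact: intc.
- exact: intc.
- move=> x; under eq_fun do rewrite E.
  by apply: integrableZr => //; exact: normal_integrable_id.
- move=> x; under eq_integral do rewrite E.
  rewrite integralZr //; last exact: normal_integrable_id.
  by rewrite normal_mean // mul0e.
Qed.

(** Here the difference of the two functions is
    [2 * c * x * y + c * (y ^+ 2 - (t - s))], whose mean in [y] vanishes by the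
    first two moments of the increment. *)
Lemma brownian_sqr_martingale s t A (c : R) :
  0 <= s -> s <= t -> t <= T -> filtration_of W s A ->
  (\int[Q]_(w in A) (c * W t w ^+ 2 - c * t)%:E
   = \int[Q]_(w in A) (c * W s w ^+ 2 - c * s)%:E)%E.
Proof.
move=> s0; rewrite le_eqVlt => /predU1P[->//|st] tT FA.
have sT := le_trans (ltW st) tT.
have t0 := le_trans s0 (ltW st).
have sg0 : 0 < Num.sqrt (t - s) by rewrite sqrtr_gt0 subr_gt0.
have sgE : Num.sqrt (t - s) ^+ 2 = t - s by rewrite sqr_sqrtr // subr_ge0 ltW.
have intc r (a : R) : 0 <= r -> r <= T ->
    Q.-integrable setT (fun w => (c * W r w ^+ 2 - a)%:E).
  move=> r0 rT; under eq_fun do rewrite EFinB EFinM.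
  apply: integrableB => //; last exact: finite_measure_integrable_cst.
  by apply: integrableZl => //; exact: brownian_sqr_integrable.
have mc (a : R) : measurable_fun [set: R] (fun x => c * x ^+ 2 - a).
  apply: measurable_funB => //; apply: measurable_funM => //.
have E x y : ((c * (x + y) ^+ 2 - c * t) - (c * x ^+ 2 - c * s))%:E
    = ((2 * c * x)%:E * y%:E + (c%:E * (y ^+ 2)%:E - (c * (t - s))%:E))%E.
  by rewrite -!EFinM -EFinB -EFinD; congr EFin; ring.
have i1 x : (normal_prob 0 (Num.sqrt (t - s))).-integrable setT
    (fun y => (2 * c * x)%:E * y%:E)%E.
  by apply: integrableZl => //; exact: normal_integrable_id.
have i2 : (normal_prob 0 (Num.sqrt (t - s))).-integrable setT
    (fun y => c%:E * (y ^+ 2)%:E)%E.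
  by apply: integrableZl => //; exact: normal_integrable_sqr.
have i3 : (normal_prob 0 (Num.sqrt (t - s))).-integrable setT
    (fun y => (c * (t - s))%:E).
  exact: finite_measure_integrable_cst.
have i23 : (normal_prob 0 (Num.sqrt (t - s))).-integrable setT
    (fun y => c%:E * (y ^+ 2)%:E - (c * (t - s))%:E)%E.
  exact: integrableB.
apply: (brownian_increment_test s t A (fun x => c * x ^+ 2 - c * t)
  (fun x => c * x ^+ 2 - c * s)) => //.
- exact: intc.
- exact: intc.
- move=> x; under eq_fun do rewrite E.
  exact: integrableD.
- move=> x; under eq_integral do rewrite E.
  rewrite integralD // integralB // !integralZl //.
  + rewrite normal_mean // mule0 add0e normal_second_moment // sgE.
    rewrite integral_cst // [X in (_ - _ * X)%E](_ : _ = 1%E).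
      by rewrite mule1 -EFinM subee.
    exact: (@probability_setT _ (measurableTypeR R)).
  + exact: normal_integrable_sqr.
  + exact: normal_integrable_id.
Qed.

End Brownian.

(** * The topology and the Borel sets of path space *)

Section PathSpaceTopology.
Variables (R : realType) (T : R) (H : normedModType R).

Lemma C0_ext (w1 w2 : C0 T H) :
  (forall t, t \in `[0, T] -> w1 t = w2 t) -> w1 = w2.
Proof.
case: w1 => f1 c1 s1 o1; case: w2 => f2 c2 s2 o2 /= eq12.
have f12 : f1 = f2.
  apply/funext => t; case: (boolP (t \in `[0, T])); first exact: eq12.
  by move=> nt; rewrite o1 // o2.
by case: _ / f12 in c2 s2 o2 *; congr MkC0; exact: Prop_irrelevance.
Qed.

Lemma evaluation_continuous t : t \in `[0, T] ->
  continuous (fun w : C0 T H => w t).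
Proof.
move=> tT w.
have cinj : {for w, continuous (@C0_fun R T H : C0 T H -> {uniform` `[0, T] -> H})}.
  exact: initial_continuous.
move=> V /nbhs_ballP[eps /= eps0 epsV].
apply: (cinj [set f | V (f t)]); apply/uniform_nbhs.
exists [set xy | ball xy.1 eps xy.2].
by split; [exact: (entourage_ball _ (PosNum eps0))|move=> f ballf; exact/epsV/ballf].
Qed.

(** Evaluations at the times of [0, T] are continuous and separate paths. *)
Lemma C0_hausdorff : hausdorff_space (C0 T H).
Proof.
move=> w1 w2 cl; apply: C0_ext => t tT.
apply: (@norm_hausdorff _ H) => A B nA nB.
have := evaluation_continuous t tT w1 A nA.
have := evaluation_continuous t tT w2 B nB.
move=> nB' nA'; have [w [wA wB]] := cl _ _ nA' nB'.
by exists (w t).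
Qed.

Lemma C0_open_measurable (U : set (C0 T H)) : open U -> measurable U.
Proof. by move=> oU; apply: sub_sigma_algebra. Qed.

Lemma C0_compact_measurable (K : set (C0 T H)) : compact K -> measurable K.
Proof.
move=> /(compact_closed C0_hausdorff) clK.
by rewrite -(setCK K); apply: measurableC; apply: C0_open_measurable; exact: closed_openC.
Qed.

Local Notation F := (filtration_of (@coord_process R T H)).

Lemma C0_continuous_measurable (f : C0 T H -> R) : continuous f -> measurable_fun setT f.
Proof.
move=> cf; apply: (measurability _ (RGenOpens.measurableE R)).
move=> _ [U [a [b ->]] <-]; rewrite setTI; apply: C0_open_measurable.
by apply: open_comp => // x _; exact: cf.
Qed.

Lemma coordinate_continuous t (f : H -> R) : t \in `[0, T] -> continuous f ->
  continuous (fun w : C0 T H => f (w t)).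
Proof.
move=> tT cf w; apply: (@continuous_comp _ _ _ (fun w : C0 T H => w t) f).
  exact: evaluation_continuous.
exact: cf.
Qed.

Lemma past_measurable s A : s <= T -> F s A -> measurable A.
Proof.
move=> sT; apply: smallest_sub; first exact: sigma_algebra_measurable.
move=> _ [r /= rs [U oU <-]]; rewrite setTI; apply: C0_open_measurable.
apply: open_comp => // w _; apply: evaluation_continuous.
by move: rs; rewrite !in_itv /= => /andP[-> /le_trans ->].
Qed.

Lemma coordinate_adapted t (V : topologicalType) (f : H -> V) : t \in `[0, T] ->
  continuous f -> forall U, open U -> F t [set w | U (f (w t))].
Proof.
rewrite in_itv /= => /andP[t0 tT] cf U oU.
apply: sub_sigma_algebra; exists t; first by rewrite /= in_itv /= t0 lexx.
exists (f @^-1` U); last by rewrite setTI.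
by apply: open_comp => // x _; exact: cf.
Qed.

End PathSpaceTopology.

(** * The law of Brownian motion along a unit vector *)

Section DeterministicLocalization.
Variables (R : realType) (T : R) (T_ge0 : 0 <= T).
Variables (d : measure_display) (O : measurableType d).
Variables (F : R -> set (set O)) (P : probability O R).
Hypotheses (F0 : forall t, F t set0) (FT : forall t, F t setT).

Lemma cst_preimage (E : Type) (B : E -> Prop) (v : E) t :
  F t [set _ : O | B v].
Proof.
have [Bv|nBv] := pselect (B v).
  by rewrite (_ : [set _ | _] = setT); [exact: FT|apply/seteqP; split].
by rewrite (_ : [set _ | _] = set0); [exact: F0|apply/seteqP; split].
Qed.

(** Only times up to [T] matter, so the constant time [T] is localizing. *)
Lemma martingale_local (V : normedModType R) (ip : V -> V -> R) (Z : R -> O -> V) :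
  martingale T F P ip Z -> local_martingale T F P ip Z.
Proof.
move=> [adZ intZ mZ].
have stopped t : t <= T -> (fun w : O => Z (Num.min t T) w) = Z t.
  by move=> tT; rewrite min_l.
exists (fun _ _ => T); split.
- by move=> n t _; exact: (cst_preimage R (fun r => r <= t) T t).
- by [].
- by move=> w m n _.
- by apply: aeW => w; exists 0%N.
- move=> _; split.
  + move=> t /[dup] tT; rewrite in_itv /= => /andP[_ tleT] U oU.
    by rewrite stopped //; exact: adZ.
  + move=> t /[dup] tT; rewrite in_itv /= => /andP[_ tleT].
    by rewrite min_l //; exact: intZ.
  + move=> s t s0 st tT A FA h.
    by rewrite !min_l // ?(le_trans st) //; exact: mZ.
Qed.

Lemma progressive_cst (V : topologicalType) (v : V) :
  progressive T F (fun _ _ => v).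
Proof.
move=> t tT U oU.
have [Uv|nUv] := pselect (U v).
  apply: sub_gen_smallest; exists `[0, t]%classic; first exact: measurable_itv.
  exists setT; first exact: FT.
  by apply/seteqP; split=> [[r w] [/= ? _]|[r w] [/= ? _]]; split.
rewrite (_ : [set _ | _] = set0); first exact: sigma_algebra0.
by apply/seteqP; split=> [[r w] [/=]|].
Qed.

End DeterministicLocalization.

Section PushforwardBrownian.
Variables (R : realType) (T : R) (T_gt0 : 0 < T).
Variables (H : completeNormedModType R) (ip : {dot H for idfun}).
Hypothesis ip_norm : forall x : H, ip x x = `|x| ^+ 2.
Variables (d : measure_display) (O : measurableType d) (Q : probability O R).
Variables (W : R -> O -> R) (W_bm : standard_brownian T Q W).
Variables (u : H) (X : {mfun O >-> C0 T H}).
Hypothesis u1 : `|u| = 1.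
Hypothesis XE : forall w t, t \in `[0, T] -> X w t = W t w *: u.

Local Notation F := (filtration_of (@coord_process R T H)).
Local Notation P := (distribution Q X).

(** The sets whose preimage lies in the past of [W] form a sigma-algebra, and it
    contains the generators because [x |-> x *: u] is continuous. This
    transfers the martingale tests from path space to the space of [W]. *)
Lemma past_preimage s A : s <= T -> F s A -> filtration_of W s (X @^-1` A).
Proof.
move=> sT; move: A; apply: smallest_sub.
  split.
  - by rewrite /= preimage_set0; exact: sigma_algebra0.
  - by move=> A FA /=; rewrite setTD preimage_setC -setTD; exact: sigma_algebraCD.
  - by move=> A FA /=; rewrite preimage_bigcup; exact: sigma_algebra_bigcup.
move=> _ [r /= rs [U oU <-]].
have rT : r \in `[0, T].
  by move: rs; rewrite !in_itv /= => /andP[-> /le_trans ->].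
apply: sub_sigma_algebra; exists r => //.
exists ((fun x : R => x *: u) @^-1` U).
  by apply: open_comp => // x _; exact: scalel_continuous.
apply/seteqP; split=> w /=; rewrite /coord_process XE //.
Qed.

Lemma law_integrable (f : C0 T H -> R) : continuous f ->
  Q.-integrable setT (fun w => (f (X w))%:E) ->
  P.-integrable setT (fun w => (f w)%:E).
Proof.
move=> cf intf; have mf := C0_continuous_measurable R T H f cf.
apply: (integrable_pushforward (measurable_funPT X)) => //.
exact/measurable_EFinP.
Qed.

Lemma law_integral A (f : C0 T H -> R) : measurable A -> continuous f ->
  Q.-integrable setT (fun w => (f (X w))%:E) ->
  (\int[P]_(w in A) (f w)%:E = \int[Q]_(w in X @^-1` A) (f (X w))%:E)%E.
Proof.
move=> mA cf intf; have mf := C0_continuous_measurable R T H f cf.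
apply: (integral_pushforward (measurable_funPT X)) => //.
- exact/measurable_EFinP.
- apply: (integrableS measurableT) => //.
  by rewrite -[_ @^-1` _]setTI; exact: measurable_funPT.
Qed.

Lemma path_in_itv t : 0 <= t -> t <= T -> t \in `[0, T].
Proof. by move=> t0 tT; rewrite in_itv /= t0. Qed.

Lemma ip_scaler (c : R) h : ip (c *: u) h = c * ip u h.
Proof. exact: linearZl_LR. Qed.

Lemma coordinate_martingale : martingale T F P ip (@coord_process R T H).
Proof.
split.
- move=> t tT U oU; by apply: (coordinate_adapted R T H t H id) => // x; exact: cvg_id.
- move=> t tT; apply: (law_integrable (fun w => `|w t|)).
    apply: (coordinate_continuous R T H t (fun x => `|x|)) => //; exact: norm_continuous.
  under eq_fun do rewrite XE // normrZ u1 mulr1.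
  move: tT; rewrite in_itv /= => /andP[t0 tleT].
  by apply: (integrable_abse (f := fun w => (W t w)%:E)); exact: (brownian_integrable R T d O Q W W_bm).
- move=> s t s0 st tT A FA h.
  have sT := le_trans st tT; have t0 := le_trans s0 st.
  have mA := past_measurable R T H s A sT FA.
  have I r : 0 <= r -> r <= T ->
      (\int[P]_(w in A) (ip (w r) h)%:E
       = \int[Q]_(w in X @^-1` A) (W r w * ip u h)%:E)%E.
    move=> r0 rT; have rI := path_in_itv r r0 rT.
    have E w : ip (X w r) h = W r w * ip u h by rewrite XE // ip_scaler.
    rewrite (law_integral A (fun w => ip (w r) h)) //.
    + by apply: eq_integral => w _; rewrite E.
    + by apply: (coordinate_continuous R T H r (ip ^~ h)) => //; exact: ip_continuous.
    + under eq_fun do rewrite E EFinM.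
      by apply: integrableZr => //; exact: (brownian_integrable R T d O Q W W_bm).
  rewrite /coord_process I // I //.
  apply: (brownian_martingale R T d O Q W W_bm) => //.
  exact: past_preimage.
Qed.

(** Along [X] the process is [W t ^+ 2 - t] times [ip u h * ip u k]. *)
Lemma bracket_martingale h k : martingale T F P ( *%R : R -> R -> R)
  (fun t w => ip (coord_process t w) h * ip (coord_process t w) k
     - \int[lebesgue_measure]_(r in `[0, t]) ip (tensor ip u u h) k).
Proof.
pose c := ip u h * ip u k.
have clock t : 0 <= t ->
    \int[lebesgue_measure]_(r in `[0, t]) ip (tensor ip u u h) k = c * t.
  move=> t0; rewrite Rintegral_cst //= /tensor ip_scaler -/c.
  rewrite lebesgue_measure_itv /= lte_fin; case: ltP => [_|t_le0].
    by rewrite -EFinB /= subr0.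
  by rewrite (le_anti (introT andP (conj t_le0 t0))).
have cont a : continuous (fun x : H => ip x h * ip x k - a).
  move=> x; apply: cvgB; last exact: cvg_cst.
  by apply: cvgM; exact: ip_continuous.
have E t w : 0 <= t -> t <= T ->
    ip (X w t) h * ip (X w t) k - c * t = c * W t w ^+ 2 - c * t.
  by move=> t0 tT; rewrite XE ?path_in_itv // !ip_scaler /c; ring.
have intE a t : 0 <= t -> t <= T ->
    Q.-integrable setT (fun w => (a * (c * W t w ^+ 2 - c * t))%:E).
  move=> t0 tT; under eq_fun do rewrite EFinM EFinB EFinM.
  apply: integrableZl => //; apply: integrableB => //.
    by apply: integrableZl => //; exact: (brownian_sqr_integrable R T d O Q W W_bm).
  exact: finite_measure_integrable_cst.
split.
- move=> t tT U oU; exact: (coordinate_adapted R T H t R (fun x => ip x h * ip x k - _)).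
- move=> t /[dup] tI; rewrite in_itv /= => /andP[t0 tT].
  under eq_fun do rewrite clock //.
  apply: (law_integrable (fun w => `|ip (w t) h * ip (w t) k - c * t|)).
    apply: (coordinate_continuous R T H t (fun x => `|ip x h * ip x k - c * t|)) => //.
    by move=> x; apply: cvg_norm; exact: cont.
  under eq_fun do rewrite E //.
  apply: (integrable_abse (f := fun w => (c * W t w ^+ 2 - c * t)%:E)).
  by have := intE 1 t t0 tT; under eq_fun do rewrite mul1r.
- move=> s t s0 st tT A FA a.
  have sT := le_trans st tT; have t0 := le_trans s0 st.
  have mA := past_measurable R T H s A sT FA.
  have I r : 0 <= r -> r <= T ->
      (\int[P]_(w in A) ((ip (w r) h * ip (w r) k - c * r) * a)%:E
       = \int[Q]_(w in X @^-1` A) (a * c * W r w ^+ 2 - a * c * r)%:E)%E.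
    move=> r0 rT; have rI := path_in_itv r r0 rT.
    rewrite (law_integral A (fun w => (ip (w r) h * ip (w r) k - c * r) * a)) //.
    + by apply: eq_integral => w _; rewrite E // mulrC mulrBr !mulrA.
    + apply: (coordinate_continuous R T H r (fun x => (ip x h * ip x k - c * r) * a)) => //.
      by move=> x; apply: cvgM; [exact: cont|exact: cvg_cst].
    + by under eq_fun do rewrite E // mulrC; exact: intE.
  rewrite clock // clock // I // I //.
  apply: (brownian_sqr_martingale R T d O Q W W_bm) => //.
  exact: past_preimage.
Qed.

(** The coordinate process is the martingale part, the drift is zero and the
    bracket density is the constant operator [u (x) u]. *)
Lemma law_in_trace_clock_class : trace_clock_class ip 1 0 P.
Proof.
have T_ge0 := ltW T_gt0.
have F0 t : F t set0 by exact: sigma_algebra0.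
have FT t : F t setT by rewrite -setC0 -setTD; apply: sigma_algebraCD; exact: F0.
exists (@coord_process R T H), (fun _ _ => 0), (fun _ _ => tensor ip u u).
split; first split.
- exact: progressive_cst.
- by apply: aeW => p _; rewrite normr0.
- apply: aeW => w t tT h.
  by rewrite linear0l Rintegral_cst // mul0r addr0.
- split; first by move=> w; exact: C0_continuous.
  apply: martingale_local; [exact: T_ge0|exact: F0|exact: FT|].
  exact: coordinate_martingale.
- split; first by move=> h k; exact: progressive_cst.
  apply: aeW => p _; have tr := tensor_trace R H ip ip_norm u.
  rewrite u1 expr1n in tr.
  split; last by exists 1.
  by split; [exact: tensor_positive|exists 1].
- move=> h k; apply: martingale_local.
  + exact: T_ge0.
  + exact: F0.
  + exact: FT.
  + exact: bracket_martingale.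
Qed.

End PushforwardBrownian.

(** * Escape from compact sets, capacity and conclusion *)

Section Compactness.
Variables (R : realType) (T : R) (T_ge0 : 0 <= T).
Variables (H : completeNormedModType R) (ip : {dot H for idfun}).
Hypothesis ip_norm : forall x : H, ip x x = `|x| ^+ 2.
Variables (e : nat -> H) (e_on : orthonormal_seq ip e).

(** The functionals [ip (w T) (e n)] are equicontinuous in the path [w] and tend
    to zero pointwise, hence uniformly on compact sets. *)
Lemma compact_uniform_coef (K : set (C0 T H)) (delta : R) :
  compact K -> 0 < delta ->
  \forall n \near \oo, forall w, K w -> `|ip (w T) (e n)| < delta.
Proof.
move=> /compact_near_coveringP cK d0.
have d2 : 0 < delta / 2 by rewrite divr_gt0.
have TI : T \in `[0, T] by rewrite in_itv /= T_ge0 lexx.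
apply: (cK nat \oo (fun n w => `|ip (w T) (e n)| < delta)) => w0 Kw0.
near=> w n.
rewrite (splitr delta) -(subrK (w0 T) (w T)) linearDl /=.
rewrite (le_lt_trans (ler_normD _ _)) // ltrD //.
  rewrite (le_lt_trans (cauchy_schwarz _ _ _ ip_norm _ _)) //.
  rewrite (orthonormal_seq_norm R H ip ip_norm e n e_on) mulr1 distrC.
  near: w.
  have /cvgrPdist_lt := evaluation_continuous R T H T TI w0.
  exact.
near: n.
have := orthonormal_coef_cvg0 R H ip ip_norm e (w0 T) e_on.
by move=> /cvgr0_norm_lt; apply.
Unshelve. all: by end_near. Qed.

End Compactness.

(** The density is at most its value at the mean. *)
Lemma normal_small_ball (R : realType) (s delta : R) : 0 < s -> 0 < delta ->
  (normal_prob 0 s `](- delta)%R, delta[%classic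
    <= (delta *+ 2 * normal_peak s)%:E)%E.
Proof.
move=> s0 d0; rewrite /normal_prob.
apply: (@le_trans _ _ (\int[lebesgue_measure]_(x in `](- delta)%R, delta[)
  (normal_peak s)%:E)%E).
  apply: ge0_le_integral => //.
  - by move=> x _; rewrite lee_fin normal_pdf_ge0.
  - by apply/measurable_funTS/measurable_EFinP; apply: measurable_normal_pdf.
  - by move=> x _; rewrite lee_fin; apply: normal_pdf_ub; rewrite gt_eqF.
rewrite integral_cst //= lebesgue_measure_itv /= lte_fin.
rewrite ifT; last by rewrite gtrN.
by rewrite -EFinB -EFinM lee_fin opprK -mulr2n mulrC.
Qed.

Section Escape.
Variables (R : realType) (T : R) (T_gt0 : 0 < T).
Variables (H : completeNormedModType R) (ip : {dot H for idfun}).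
Hypothesis ip_norm : forall x : H, ip x x = `|x| ^+ 2.
Variables (e : nat -> H) (e_on : orthonormal_seq ip e).
Variables (d : measure_display) (O : measurableType d) (Q : probability O R).
Variables (W : R -> O -> R) (W_bm : standard_brownian T Q W).
Variable X : nat -> {mfun O >-> C0 T H}.
Hypothesis XE : forall n w t, t \in `[0, T] -> X n w t = W t w *: e n.

(** Under the law of index [n], the functional [ip (w T) (e n)] is distributed as
    [W T] for every [n], while it is uniformly small on [K] for large [n]. *)
Lemma compact_complement_law_sup (K : set (C0 T H)) : compact K ->
  ereal_sup [set distribution Q (X n) (~` K) | n in [set: nat]] = 1%E.
Proof.
move=> cK; have mK := C0_compact_measurable R T H K cK.
apply/eqP; rewrite eq_le; apply/andP; split.
  by apply: ge_ereal_sup => _ [n _ <-]; apply: probability_le1; exact: measurableC.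
apply/lee_subgt0Pr => eps eps0.
pose s := Num.sqrt T; have s0 : 0 < s by rewrite sqrtr_gt0.
have peak0 : 0 < normal_peak s by rewrite normal_peak_gt0 // gt_eqF.
(* The interval of half-length [delta] has mass at most [eps]. *)
pose delta := eps / (2 * normal_peak s).
have delta0 : 0 < delta by rewrite divr_gt0 // mulr_gt0.
have [n _ /(_ n (leqnn n)) Kn] :=
  compact_uniform_coef R T (ltW T_gt0) H ip ip_norm e e_on K delta cK delta0.
have TI : T \in `[0, T] by rewrite in_itv /= (ltW T_gt0) lexx.
have small : (distribution Q (X n) K <= eps%:E)%E.
  have -> : eps = delta *+ 2 * normal_peak s.
    by rewrite /delta; field; rewrite gt_eqF.
  apply: (le_trans _ (normal_small_ball R s delta s0 delta0)).
  case: W_bm => mW W0 _ law _.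
  have := law 0 T (lexx 0) T_gt0 (lexx T) `](- delta), delta[%classic.
  rewrite subr0 => <- //.
  have -> : (W T \- W 0)%R = W T by apply/funext => w /=; rewrite W0 subr0.
  change (Q (X n @^-1` K) <= Q (W T @^-1` `](- delta)%R, delta[%classic))%E.
  apply: le_measure; rewrite ?inE.
  - by rewrite -[_ @^-1` _]setTI; exact: measurable_funPT.
  - by rewrite -[_ @^-1` _]setTI; apply: (mW T TI).
  - move=> w /= /Kn; rewrite XE // linearZl_LR /= e_on eqxx mulr1.
    by rewrite in_itv /= -ltr_norml.
apply: le_trans; last by apply: ereal_sup_ubound; exists n.
rewrite probability_setC // leeB //.
Qed.

End Escape.

Section Capacity.
Variables (R : realType) (d : measure_display) (O : measurableType d).
Implicit Types P : probability O R.

Lemma outer_prob_measurable P (E : set O) : measurable E -> outer_prob P E = P E.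
Proof.
move=> mE; apply/eqP; rewrite eq_le; apply/andP; split.
  by apply: ereal_inf_lbound; exists E => //; split.
by apply: le_ereal_inf_tmp => _ [A [mA EA] <-]; apply: le_measure; rewrite ?inE.
Qed.

Lemma outer_prob_le1 P (E : set O) : (outer_prob P E <= 1)%E.
Proof.
rewrite -(probability_setT P); apply: ereal_inf_lbound.
by exists setT => //; split.
Qed.

End Capacity.

Theorem theorem6p1 (R : realType) (T : R) (T_gt0 : 0 < T)
  (H : completeNormedModType R) (ip : {dot H for idfun})
  (ip_norm : forall x : H, ip x x = `|x| ^+ 2)
  (sepH : separable_space H) (infH : infinite_dimensional H)
  (e : nat -> H) (e_on : orthonormal_seq ip e)
  (d : measure_display) (O : measurableType d) (Q : probability O R)
  (W : R -> O -> R) (W_bm : standard_brownian T Q W)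
  (X : nat -> {mfun O >-> C0 T H})
  (X_def : forall n w t, t \in `[0, T] -> X n w t = W t w *: e n)
  (PP : nat -> probability (C0 T H) R)
  (PP_law : forall n, PP n = distribution Q (X n)) :
  [/\ forall n, trace_clock_class ip 1 0 (PP n),
      forall K : set (C0 T H), compact K ->
        ereal_sup [set PP n (~` K) | n in [set: nat]] = 1%E /\
        capacity (trace_clock_class (T:=T) ip 1 0) (~` K) = 1%E,
      ~ uniformly_tight (trace_clock_class (T:=T) ip 1 0),
      ~ (exists K, compact_capacity_core (trace_clock_class (T:=T) ip 1 0) K)
    & ~ (exists2 G : H -> H, positive_trace_class ip G
           & forall n, op_le ip (tensor ip (e n) (e n)) G)].
Proof.
have inC n : trace_clock_class ip 1 0 (PP n).
  rewrite PP_law.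
  apply: (law_in_trace_clock_class R T T_gt0 H ip ip_norm d O Q W W_bm (e n)).
    exact: (orthonormal_seq_norm R H ip ip_norm e n e_on).
  exact: X_def.
have sup1 K : compact K -> ereal_sup [set PP n (~` K) | n in [set: nat]] = 1%E.
  move=> cK.
  rewrite -(compact_complement_law_sup R T T_gt0 H ip ip_norm e e_on d O Q W W_bm
    X X_def K cK).
  by congr ereal_sup; apply/seteqP; split=> x [n _ <-]; exists n; rewrite // PP_law.
have cap1 K : compact K -> capacity (trace_clock_class (T:=T) ip 1 0) (~` K) = 1%E.
  move=> cK; have mK := C0_compact_measurable R T H K cK.
  apply/eqP; rewrite eq_le; apply/andP; split.
    by apply: ge_ereal_sup => _ [P _ <-]; exact: outer_prob_le1.
  rewrite -(sup1 K cK); apply: ge_ereal_sup => _ [n _ <-].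
  apply: ereal_sup_ubound; exists (PP n) => //.
  by apply: outer_prob_measurable; exact: measurableC.
split; [exact: inC|by move=> K cK; rewrite sup1 // cap1|..].
- move=> tight; have [K cK] := tight 1 ltr01; apply/negP; rewrite -leNgt -(sup1 K cK).
  by apply: ereal_sup_le => _ [n _ <-]; exists (PP n).
- move=> [K [cK _ K0]].
  have : capacity (trace_clock_class (T:=T) ip 1 0) (~` (K n)) @[n --> \oo]
      --> (1%E : \bar R).
    rewrite (eq_cvg _ _ (fun n => cap1 (K n) (cK n))); exact: cvg_cst.
  move=> /(cvg_unique (@ereal_hausdorff R) K0)/eqP.
  by rewrite eq_sym onee_eq0.
- exact: (no_trace_class_majorant R H ip ip_norm e e_on).
Qed.
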